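(* Let $L\subseteq\mathbb Z^r$ be a lattice. If $L$ is homogeneous, then $V_X(I_L)\cap T_X$ is a submonoid of $T_X$.
   Context: Setting. $X$ is a complete simplicial toric variety over a field $\mathbb K$ given by a fan $\Sigma\subset\mathbb R^n$ with rays $\rho_1,\dots,\rho_r$ and corresponding primitive lattice generators $\mathbf v_1,\dots,\mathbf v_r\in\mathbb Z^n$. The matrix $\phi:\mathbb Z^n\to\mathbb Z^r$ has rows $\mathbf v_1,\dots,\mathbf v_r$, and there is an exact sequence $0\to\mathbb Z^n\xrightarrow{\phi}\mathbb Z^r\xrightarrow{\beta}\mathcal A\to 0$ with $\mathcal A\cong \mathrm{Cl}(X)$. The Cox ring $S=\mathbb K[x_1,\dots,x_r]$ is graded by $\mathcal A$ via $\deg x_j=\beta_j:=\beta(e_j)$; ''homogeneous'' for polynomials and ideals refers to this grading. Let $\mathbf u_1,\dots,\mathbf u_n\in\mathbb Z^r$ be the columns of $\phi$, write $\mathbf t^{\mathbf u}=t_1^{u_1}\cdots t_r^{u_r}$, let $\pi:(\mathbb K^* )^r\to T_X\cong(\mathbb K^* )^n$, $\pi(\mathbf t)=(\mathbf t^{\mathbf u_1},\dots,\mathbf t^{\mathbf u_n})$, and $G=\ker\pi$. The torus $T_X$ is split and $1\to G\to(\mathbb K^* )^r\xrightarrow{\pi}T_X\to1$ is assumed exact, so $T_X=(\mathbb K^* )^r/G$. The irrelevant ideal is $B=\langle \prod_{\rho_i\notin\sigma}x_i : \sigma\in\Sigma\rangle$; the order of the torsion part of $\mathcal A$ is assumed coprime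 to the characteristic of $\mathbb K$, and points of $X$ are identified with orbits: $X=(\mathbb K^r\setminus V(B))/G$, with $[P]=G\cdot P$. The group law on $T_X$ is $[P][P']=[PP']$ (coordinatewise). A lattice is a subgroup $L\subseteq\mathbb Z^r$; it is homogeneous if $L\subseteq L_\beta:=\operatorname{Ker}\beta=\operatorname{Im}\phi$. Writing $\mathbf m=\mathbf m^+-\mathbf m^-$ with $\mathbf m^{\pm}\in\mathbb N^r$ the positive and negative parts, $I_L=\langle \mathbf x^{\mathbf m^+}-\mathbf x^{\mathbf m^-} : \mathbf m\in L\rangle$. For a homogeneous ideal $J\subseteq S$, $V_X(J)=\{[P]\in X : F(P)=0\text{ for all homogeneous }F\in J\}$. *)

(* Defs.v *)
From HB Require Import structures.
From mathcomp Require Import all_boot all_order all_algebra.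
From mathcomp Require Import mathcomp_extra boolp classical_sets functions.
From mathcomp Require Import cardinality reals.
From mathcomp Require Import mpoly.

Set Implicit Arguments.
Unset Strict Implicit.
Unset Printing Implicit Defensive.
Import Order.TTheory GRing.Theory Num.Theory.
Local Open Scope classical_set_scope.
Local Open Scope ring_scope.

(* The cone spanned by the rows of M. *)
Definition cone (R : realType) (n k : nat) (M : 'M[R]_(k, n)) : set 'rV[R]_n :=
  [set x | exists2 c : 'rV[R]_k, (forall i, 0 <= c 0 i) & x = c *m M].

Definition rational_polyhedral (R : realType) (n : nat) (C : set 'rV[R]_n) :=
  exists k (M : 'M[int]_(k, n)), C = cone (map_mx intr M).

Definition strongly_convex (R : realType) (n : nat) (C : set 'rV[R]_n) :=
  forall x, C x -> C (- x) -> x = 0.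

(* The column u is a linear form on R^n: faces are cut out by supporting
   hyperplanes. In particular C is a face of itself. *)
Definition face (R : realType) (n : nat) (F C : set 'rV[R]_n) :=
  exists2 u : 'cV[R]_n, (forall x, C x -> 0 <= (x *m u) 0 0)
    & F = [set x | C x /\ (x *m u) 0 0 = 0].

(* The dimension of a cone is the dimension of its linear span. *)
Definition has_dim (R : realType) (n : nat) (C : set 'rV[R]_n) (d : nat) :=
  exists k (M : 'M[R]_(k, n)), C = cone M /\ \rank M = d.

Definition simplicial_cone (R : realType) (n : nat) (C : set 'rV[R]_n) :=
  exists k (M : 'M[R]_(k, n)), C = cone M /\ row_free M.

Record is_fan (R : realType) (n : nat) (Sigma : set (set 'rV[R]_n)) : Prop := {
  fan_finite : finite_set Sigma;
  fan_rational : forall C, Sigma C -> rational_polyhedral C;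
  fan_strongly_convex : forall C, Sigma C -> strongly_convex C;
  fan_face : forall C F, Sigma C -> face F C -> Sigma F;
  fan_meet : forall C D, Sigma C -> Sigma D ->
    face (C `&` D) C /\ face (C `&` D) D }.

Definition simplicial_fan (R : realType) (n : nat)
    (Sigma : set (set 'rV[R]_n)) :=
  forall C, Sigma C -> simplicial_cone C.

Definition complete_fan (R : realType) (n : nat)
    (Sigma : set (set 'rV[R]_n)) :=
  forall x, exists2 C, Sigma C & C x.

(* The half-line spanned by v_i, the i-th row of phi. *)
Definition ray (R : realType) (r n : nat) (phi : 'M[int]_(r, n)) (i : 'I_r) :
    set 'rV[R]_n :=
  cone (map_mx intr (row i phi)).

Definition primitive_vector (n : nat) (v : 'rV[int]_n) :=
  \big[gcdn/0%N]_(j < n) absz (v 0 j) = 1%N.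

(* The rows of phi list, without repetition, the primitive generators of the
   rays of Sigma. *)
Record ray_matrix (R : realType) (r n : nat) (Sigma : set (set 'rV[R]_n))
    (phi : 'M[int]_(r, n)) : Prop := {
  ray_primitive : forall i, primitive_vector (row i phi);
  ray_inj : injective (@ray R r n phi);
  ray_range : range (@ray R r n phi) = [set C | Sigma C /\ has_dim C 1] }.

(* Exactness of 0 -> Z^n -> Z^r -> A -> 0, with phi acting on columns. *)
Record short_exact (r n : nat) (A : zmodType) (phi : 'M[int]_(r, n))
    (beta : {additive 'cV[int]_r -> A}) : Prop := {
  phi_inj : injective (fun u : 'cV[int]_n => phi *m u);
  phi_range : range (fun u : 'cV[int]_n => phi *m u) = [set m | beta m = 0];
  beta_surj : forall a, exists m, beta m = a }.

(* In characteristic 0 the coprimality condition is void. *)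
Definition torsion_coprime_char (A : zmodType) (K : fieldType) :=
  exists s : seq A, [/\ uniq s,
    forall a, a \in s <-> (exists2 m, (0 < m)%N & a *+ m = 0)
    & forall p, p \in [pchar K] -> coprime (size s) p].

Section Cox.
Variables (K : fieldType) (r : nat).

Definition ideal_gen (E : set {mpoly K[r]}) : set {mpoly K[r]} :=
  [set F | exists k (a g : 'I_k -> {mpoly K[r]}),
     (forall i, E (g i)) /\ F = \sum_(i < k) a i * g i].

Definition affine_zeros (J : set {mpoly K[r]}) : set {ffun 'I_r -> K} :=
  [set P | forall F, J F -> F.@[P] = 0].

Definition irrelevant_ideal (R : realType) (n : nat)
    (Sigma : set (set 'rV[R]_n)) (phi : 'M[int]_(r, n)) :
    set {mpoly K[r]} :=
  ideal_gen [set \prod_(i < r | ~~ `[< face (ray phi i) C >]) 'X_i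
            | C in Sigma].

Definition cox_deg (A : zmodType) (beta : {additive 'cV[int]_r -> A})
    (m : 'X_{1..r}) : A :=
  \sum_(j < r) beta (delta_mx j 0) *+ m j.

Definition homogeneous (A : zmodType) (beta : {additive 'cV[int]_r -> A})
    (F : {mpoly K[r]}) :=
  exists a : A, forall m, m \in msupp F -> cox_deg beta m = a.

Definition torus (k : nat) : set {ffun 'I_k -> K} :=
  [set t | forall i, t i != 0].

Definition torus_map (n : nat) (phi : 'M[int]_(r, n))
    (t : {ffun 'I_r -> K}) : {ffun 'I_n -> K} :=
  [ffun j => \prod_(i < r) t i ^ phi i j].

Definition torus_ker (n : nat) (phi : 'M[int]_(r, n)) :
    set {ffun 'I_r -> K} :=
  [set t | torus t /\ torus_map phi t = 1].

(* Products in {ffun 'I_r -> K} are coordinatewise. *)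
Definition G_orbit (n : nat) (phi : 'M[int]_(r, n)) (P : {ffun 'I_r -> K}) :
    set {ffun 'I_r -> K} :=
  [set g * P | g in torus_ker phi].

(* The points of X are the orbits, as subsets of K^r. *)
Definition toric_points (R : realType) (n : nat)
    (Sigma : set (set 'rV[R]_n)) (phi : 'M[int]_(r, n)) :
    set (set {ffun 'I_r -> K}) :=
  [set G_orbit phi P | P in ~` affine_zeros (irrelevant_ideal Sigma phi)].

Definition torus_points (n : nat) (phi : 'M[int]_(r, n)) :
    set (set {ffun 'I_r -> K}) :=
  [set G_orbit phi P | P in @torus r].

(* Multiplication of cosets; see G_orbit_mulE. *)
Definition G_orbit_mul (O O' : set {ffun 'I_r -> K}) : set {ffun 'I_r -> K} :=
  [set P * P' | P in O & P' in O'].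

Definition toric_zeros (R : realType) (n : nat) (A : zmodType)
    (Sigma : set (set 'rV[R]_n)) (phi : 'M[int]_(r, n))
    (beta : {additive 'cV[int]_r -> A}) (J : set {mpoly K[r]}) :
    set (set {ffun 'I_r -> K}) :=
  [set O | toric_points Sigma phi O /\
     exists2 P, O = G_orbit phi P
       & forall F, J F -> homogeneous beta F -> F.@[P] = 0].

Definition pos_part (m : 'cV[int]_r) : 'X_{1..r} :=
  [multinom absz (Num.max (m i 0) 0)%R | i < r].

Definition neg_part (m : 'cV[int]_r) : 'X_{1..r} := pos_part (- m).

Definition lattice_ideal (L : set 'cV[int]_r) : set {mpoly K[r]} :=
  ideal_gen [set 'X_[pos_part m] - 'X_[neg_part m] | m in L].

Lemma G_orbit_mulE (n : nat) (phi : 'M[int]_(r, n)) (P P' : {ffun 'I_r -> K}) :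
  G_orbit_mul (G_orbit phi P) (G_orbit phi P') = G_orbit phi (P * P').
Proof.
apply/seteqP; split => [_ [_ [g [gt gk] <-]] [_ [h [ht hk] <-]] <-|_ [g gG <-]].
  exists (g * h); last first.
    by apply/ffunP => i; rewrite !ffunE mulrACA.
  split => [i|]; first by rewrite ffunE mulf_neq0.
  apply/ffunP => j; rewrite !ffunE.
  under eq_bigr do rewrite ffunE expfzMl.
  rewrite big_split /=.
  by move/ffunP/(_ j): gk; move/ffunP/(_ j): hk; rewrite !ffunE => -> ->; rewrite mulr1.
exists (g * P); first by exists g.
exists P'; last by apply/ffunP => i; rewrite !ffunE mulrA.
exists 1; last by apply/ffunP => i; rewrite !ffunE mul1r.
split => [i|]; first by rewrite ffunE oner_neq0.
by apply/ffunP => j; rewrite !ffunE big1 // => i _; rewrite ffunE exp1rz.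
Qed.

End Cox.

Arguments torus K k : clear implicits.
Arguments torus_map K {r n} phi t.
Arguments torus_points K {r n} phi.
Arguments irrelevant_ideal K {r R n} Sigma phi.
Arguments G_orbit_mul K r : clear implicits.
Arguments lattice_ideal K {r} L.

Definition lattice (r : nat) (L : set 'cV[int]_r) := zmod_closed (mem L).

Definition homogeneous_lattice (r : nat) (A : zmodType)
    (beta : {additive 'cV[int]_r -> A}) (L : set 'cV[int]_r) :=
  L `<=` [set m | beta m = 0].

Record is_submonoid (T : Type) (M : set T) (mul : T -> T -> T) (e : T)
    (N : set T) : Prop := {
  submonoid_sub : N `<=` M;
  submonoid_one : N e;
  submonoid_mul : forall x y, N x -> N y -> N (mul x y) }.

(* Main.v *)
Require Import Defs.
From HB Require Import structures.
From mathcomp Require Import all_boot all_order all_algebra.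
From mathcomp Require Import mathcomp_extra boolp classical_sets functions.
From mathcomp Require Import cardinality reals.
From mathcomp Require Import mpoly.

Set Implicit Arguments.
Unset Strict Implicit.
Unset Printing Implicit Defensive.
Import Order.TTheory GRing.Theory Num.Theory.
Local Open Scope classical_set_scope.
Local Open Scope ring_scope.

(** Evaluating a monomial at a coordinatewise product multiplies the two values,
so the binomial equations P^(m+) = P^(m-), for m in L, define a set of points of
K^r that contains 1 and is closed under products.  What has to be checked is
that these equations alone describe the torus points of V_X(I_L), which is
[toric_zeros_torusE].  One direction uses that L is homogeneous: each
x^(m+) - x^(m-) is then homogeneous for the grading by A
([homogeneous_binomial]), because beta m = 0 is the difference of the degrees of
its two monomials; so it is among the polynomials that are tested at points of
V_X(I_L).  In the other direction, a point satisfying the binomial equations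
kills the whole ideal, and a torus point does represent a point of X, since the
generators of the irrelevant ideal are monomials and completeness of the fan
provides at least one of them. *)

Section IdealGen.
Variables (K : fieldType) (r : nat).
Implicit Types (E : set {mpoly K[r]}) (P : {ffun 'I_r -> K}).

Lemma mem_ideal_gen E F : E F -> ideal_gen E F.
Proof.
move=> EF; exists 1%N, (fun=> 1), (fun=> F); split=> //.
by rewrite big_ord1 mul1r.
Qed.

Lemma ideal_gen_meval0 E P :
  (forall F, E F -> F.@[P] = 0) -> forall F, ideal_gen E F -> F.@[P] = 0.
Proof.
move=> E0 _ [k [a [g [Eg ->]]]]; rewrite raddf_sum big1 //= => i _.
by rewrite mevalM (E0 _ (Eg i)) mulr0.
Qed.

End IdealGen.

Section Torus.
Variables (K : fieldType) (r : nat).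
Implicit Types P Q : {ffun 'I_r -> K}.

Lemma torus1 : torus K r 1.
Proof. by move=> i; rewrite ffunE oner_neq0. Qed.

Lemma torusM P Q : torus K r P -> torus K r Q -> torus K r (P * Q).
Proof. by move=> tP tQ i; rewrite ffunE mulf_neq0. Qed.

Lemma meval_monom1 (m : 'X_{1..r}) :
  'X_[m].@[(1 : {ffun 'I_r -> K})] = 1 :> K.
Proof. by rewrite mevalX big1 // => i _; rewrite ffunE expr1n. Qed.

Lemma meval_monomM (m : 'X_{1..r}) P Q :
  'X_[m].@[P * Q] = 'X_[m].@[P] * 'X_[m].@[Q].
Proof.
rewrite !mevalX -big_split; apply: eq_bigr => i _ /=.
by rewrite ffunE exprMn.
Qed.

Lemma G_orbit_refl n (phi : 'M[int]_(r, n)) P : G_orbit phi P P.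
Proof.
exists 1; last by apply/ffunP => i; rewrite !ffunE mul1r.
split; first exact: torus1.
by apply/ffunP => j; rewrite !ffunE big1 // => i _; rewrite ffunE exp1rz.
Qed.

Lemma G_orbit_torus n (phi : 'M[int]_(r, n)) P Q :
  torus K r P -> G_orbit phi P Q -> torus K r Q.
Proof. by move=> tP [g [tg _] <-]; exact: torusM. Qed.

(** A cone through 0 yields a monomial in the irrelevant ideal, and monomials
have no zero on the torus. *)
Lemma torus_toric_points (R : realType) n (Sigma : set (set 'rV[R]_n))
    (phi : 'M[int]_(r, n)) P :
  complete_fan Sigma -> torus K r P -> toric_points Sigma phi (G_orbit phi P).
Proof.
move=> /(_ 0) [C SC _] tP; exists P => // P0.
have /P0 : irrelevant_ideal K Sigma phi
    (\prod_(i < r | ~~ `[< face (ray phi i) C >]) 'X_i).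
  by apply: mem_ideal_gen; exists C.
apply/eqP; rewrite rmorph_prod /=; apply/prodf_neq0 => i _.
by rewrite mevalXU.
Qed.

End Torus.

Section Binomials.
Variables (r : nat) (A : zmodType) (beta : {additive 'cV[int]_r -> A}).

Lemma cox_deg_pos_neg (m : 'cV[int]_r) :
  cox_deg beta (pos_part m) - cox_deg beta (neg_part m) = beta m.
Proof.
have -> : beta m = \sum_(j < r) beta (delta_mx j 0) *~ m j 0.
  rewrite {1}[m]matrix_sum_delta raddf_sum; apply: eq_bigr => j _.
  by rewrite big_ord1 -raddfMz -scaler_int intz.
rewrite /cox_deg -sumrB; apply: eq_bigr => j _; rewrite !mnmE mxE.
by case: (m j 0) => [[|k]|k]; rewrite ?subr0 ?mulr0z // sub0r.
Qed.

Lemma homogeneous_binomial (K : fieldType) (m : 'cV[int]_r) :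
  beta m = 0 ->
  homogeneous beta ('X_[pos_part m] - 'X_[neg_part m] : {mpoly K[r]}).
Proof.
rewrite -cox_deg_pos_neg => /subr0_eq degE.
exists (cox_deg beta (pos_part m)) => k /msuppB_le.
by rewrite mem_cat !msuppX !inE => /orP[] /eqP ->.
Qed.

(** The representative appearing in [toric_zeros] need not be the given torus
point, but it lies in its orbit and hence in the torus; this is why the right
hand side can ask for a single point with both properties. *)
Lemma toric_zeros_torusE (K : fieldType) (R : realType) n
    (Sigma : set (set 'rV[R]_n)) (phi : 'M[int]_(r, n)) (L : set 'cV[int]_r) :
  complete_fan Sigma -> homogeneous_lattice beta L ->
  toric_zeros Sigma phi beta (lattice_ideal K L) `&` torus_points K phi =
  [set G_orbit phi P | P in [set P | torus K r P /\
     forall m, L m -> 'X_[pos_part m].@[P] = 'X_[neg_part m].@[P] :> K]].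
Proof.
move=> Sc Lh; apply/seteqP; split=> [O [[_ [P -> P0]] [Q tQ QP]]|_ [P [tP PL] <-]].
  exists P => //; split=> [|m Lm].
    by apply: (G_orbit_torus tQ (phi := phi)); rewrite QP; exact: G_orbit_refl.
  apply/subr0_eq; rewrite -mevalB; apply: P0.
    by apply: mem_ideal_gen; exists m.
  exact/homogeneous_binomial/Lh.
split; last by exists P.
split; first exact: torus_toric_points.
exists P => // F + _; apply: ideal_gen_meval0 => _ [m Lm <-].
by rewrite mevalB PL // subrr.
Qed.

End Binomials.

Theorem corollary2p4 (K : fieldType) (R : realType) (n r : nat)
    (Sigma : set (set 'rV[R]_n)) (phi : 'M[int]_(r, n))
    (A : zmodType) (beta : {additive 'cV[int]_r -> A})
    (Sigma_fan : is_fan Sigma)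
    (Sigma_simplicial : simplicial_fan Sigma)
    (Sigma_complete : complete_fan Sigma)
    (phi_rays : ray_matrix Sigma phi)
    (phi_beta_exact : short_exact phi beta)
    (torus_exact : torus_map K phi @` torus K r = torus K n)
    (char_coprime : torsion_coprime_char A K)
    (L : set 'cV[int]_r) (L_lattice : lattice L) :
  homogeneous_lattice beta L ->
  is_submonoid (torus_points K phi) (G_orbit_mul K r) (G_orbit phi (1 : {ffun 'I_r -> K}))
    (toric_zeros Sigma phi beta (lattice_ideal K L) `&` torus_points K phi).
Proof.
move=> Lh; split; first by move=> O [].
  rewrite toric_zeros_torusE //; exists 1 => //.
  by split=> [|m _]; [exact: torus1 | rewrite !meval_monom1].
rewrite toric_zeros_torusE // => _ _ [P [tP PL] <-] [Q [tQ QL] <-].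
rewrite G_orbit_mulE; exists (P * Q) => //; split; first exact: torusM.
by move=> m Lm; rewrite !meval_monomM PL // QL.
Qed.
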